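(* Let $(\mu,\sigma)$, $\tau$, $W(\cdot)$ be jointly independent, where $W$ is a standard Wiener process, $\tau>0$ a.s. is a random variable, and $\mu,\sigma$ are random variables such that, for some constants $\underline{\mu},\overline{\sigma}$, one has $\mu\ge\underline{\mu}>-\infty$ and $0<\sigma\le\overline{\sigma}<\infty$ a.s. Put $\nu:=-(\mu-\sigma^2/2)\tau-\sigma W(\tau)$. Assume that $$\mathbf{E}(\mu-\sigma^2/2)>0,\qquad q_\tau<\infty,\qquad \phi_\tau(q_\tau)=\infty .$$ Then, with $q_+$ and $F_H$ as defined in the context, $q_\nu=q_+$ and, moreover, $\phi_\nu(q_\nu)=\infty$ if and only if $$\int_0^{\delta}\phi_\tau(q_\tau-h)\,dF_H(h)=\infty$$ for some (and then for any) $\delta>0$.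
   Context: For a random variable $V$, $\phi_V(q):=\mathbf{E}e^{qV}$ for $q\in\mathbb{R}$ and $q_V:=\sup\{q\in\mathbb{R}:\phi_V(q)<\infty\}$. This is the setting where an insurer's investment return has random drift $\mu$ and volatility $\sigma$ that stay constant during an inter-claim time $\tau$; $-\nu$ is the log-return over that period. Let $\Theta:=(\mu,\sigma^2/2)$, let $D\subseteq[\underline{\mu},\infty)\times[0,\overline{\sigma}^2/2]$ be the support of the distribution of $\Theta$, and let $\langle\cdot,\cdot\rangle$ be the inner product in $\mathbb{R}^2$. For $q\in\mathbb{R}$ put $u(q):=(-q,\,q(q+1))$, and for $q>0$ let $$L_q:=\{(x,y)\in\mathbb{R}\times[0,\infty):\langle u(q),(x,y)\rangle=q_\tau\},$$ i.e. the ray $y=\frac{x}{q+1}+\frac{q_\tau}{q(q+1)}$, $x\ge-q_\tau/q$. Define $$q_+:=\inf\{q>0:L_q\cap D\ne\varnothing\},$$ which is a finite positive number. Let $$H:=\langle u(q_+),\theta_+-\Theta\rangle=q_\tau+q_+\mu-q_+(q_++1)\sigma^2/2$$ (the value does not depend on the choice of $\theta_+\in L_{q_+}$); one has $H\ge0$ a.s. Denote by $F_H$ the distribution function of $H$. The integral $\int_0^\delta\phi_\tau(q_\tau-h)\,dF_H(h)$ is over $[0,\delta]$, i.e. it equals $\mathbf{E}[\phi_\tau(q_\tau-H);H\le\delta]$ (including a possible atom of $F_H$ at $0$, where $\phi_\tau(q_\tau)=\infty$). *)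

(* Defs.v *)
From HB Require Import structures.
From mathcomp Require Import all_boot all_order all_algebra.
From mathcomp Require Import all_classical all_reals all_analysis.
From mathcomp Require Import measurable_realfun.

Set Implicit Arguments.
Unset Strict Implicit.
Unset Printing Implicit Defensive.

Import Order.TTheory GRing.Theory Num.Theory.
Import numFieldNormedType.Exports.

Local Open Scope classical_set_scope.
Local Open Scope ring_scope.

Section independence.
Context {d : measure_display} {T : measurableType d} {R : realType}.
Variable P : probability T R.

(* Mutual independence of finitely many sub-sigma-algebras F i.  Each F i
   contains setT, so the full product rule gives that of every subfamily. *)
Definition independent_sigma {I : finType} (F : I -> set_system T) : Prop :=
  forall A : I -> set T, (forall i, F i (A i)) ->
    P (\bigcap_(i in [set: I]) A i) = (\prod_(i : I) P (A i))%E.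

End independence.

Section wiener.
Context {d : measure_display} {T : measurableType d} {R : realType}.
Variables (P : probability T R) (W : R -> {RV P >-> R}).

(* Time runs over [0, +oo[; the values W t for t < 0 are junk and are never
   constrained or used. *)
Record standard_wiener : Prop := StandardWiener {
  wiener0 : {ae P, forall w, W 0 w = 0} ;
  wiener_independent_increments : forall (n : nat) (t : nat -> R),
    0 <= t 0%N -> (forall i, t i <= t i.+1) ->
    independent_sigma P
      (fun i : 'I_n => g_sigma_algebra_preimage (W (t i.+1) \- W (t i))) ;
  wiener_normal_increments : forall (s t : R), 0 <= s -> s < t ->
    forall A : set R, measurable A ->
      P ((W t \- W s) @^-1` A) = normal_prob 0 (Num.sqrt (t - s)) A ;
  wiener_continuous_paths :
    {ae P, forall w, {within `[0, +oo[, continuous (fun t : R => W t w)}} }.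

Definition process_sigma : set_system T :=
  <<s \bigcup_(t in [set t : R | 0 <= t]) g_sigma_algebra_preimage (W t) >>.

End wiener.

Section transforms.
Context {d : measure_display} {T : measurableType d} {R : realType}.
Variable P : probability T R.

(* q_V = sup {q | phi_V(q) < oo}, where phi_V = 'M_P V. *)
Definition mgf_abscissa (V : T -> R) : \bar R :=
  ereal_sup [set q%:E | q in [set q : R | ('M_P V q < +oo)%E]].

End transforms.

Section real_cdf.
Context {d : measure_display} {T : measurableType d} {R : realType}.
Variables (P : probability T R) (X : {RV P >-> R}).

(* The library's cdf takes values in \bar R; Stieltjes measures are built from
   real-valued cumulative functions. *)
Definition real_cdf (r : R) : R := fine (cdf X r).

Lemma real_cdf_nondecreasing : nondecreasing real_cdf.
Proof. by move=> *; rewrite fine_le ?fin_num_measure// cdf_nondecreasing. Qed.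

Lemma real_cdf_right_continuous : right_continuous real_cdf.
Proof.
move=> a; apply: fine_cvg.
by rewrite fineK ?fin_num_measure//; exact: cdf_right_continuous.
Qed.

HB.instance Definition _ := isCumulative.Build R _ R real_cdf
  real_cdf_nondecreasing real_cdf_right_continuous.

End real_cdf.

Section geometry.
Context {R : realType}.

Definition dot2 (a b : R * R) : R := a.1 * b.1 + a.2 * b.2.

Definition uvec (q : R) : R * R := (- q, q * (q + 1)).

Definition Lray (q_tau q : R) : set (R * R) :=
  [set z | 0 <= z.2 /\ dot2 (uvec q) z = q_tau].

Definition dist_support (m : set (R * R) -> \bar R) : set (R * R) :=
  [set z | forall U : set (R * R), open U -> U z -> (0 < m U)%E].

(* Real-valued inf, meant for sets that are nonempty. *)
Definition first_hit (q_tau : R) (D : set (R * R)) : R :=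
  inf [set q | 0 < q /\ Lray q_tau q `&` D !=set0].

End geometry.

Section model.
Context {d : measure_display} {T : measurableType d} {R : realType}.
Variables (P : probability T R) (mu sigma : {RV P >-> R}).

Definition Theta (w : T) : R * R := (mu w, sigma w ^+ 2 / 2).

(* The value for theta on the ray is independent of theta; see gapE. *)
Definition gap (q : R) (theta : R * R) (w : T) : R :=
  dot2 (uvec q) (theta - Theta w).

Lemma measurable_gap q theta : measurable_fun setT (gap q theta).
Proof.
apply: measurable_funD; apply: measurable_funM => //=; apply: measurable_funB => //=.
by apply: measurable_funM => //; exact: measurable_funX.
Qed.

HB.instance Definition _ q theta :=
  isMeasurableFun.Build _ _ _ _ (gap q theta) (measurable_gap q theta).

Lemma gapE q_tau q theta w : Lray q_tau q theta ->
  gap q theta w = q_tau + q * mu w - q * (q + 1) * sigma w ^+ 2 / 2.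
Proof.
move=> [_ <-]; rewrite /gap /dot2 /= !mulrBr !mulNr opprK addrACA.
by rewrite addrA mulrA.
Qed.

(* Sampled at the random time tau; since the paths of W are only almost surely
   continuous, this is in general only almost everywhere equal to a measurable
   function. *)
Definition log_loss (tau : {RV P >-> R}) (W : R -> {RV P >-> R}) (w : T) : R :=
  - (mu w - sigma w ^+ 2 / 2) * tau w - sigma w * W (tau w) w.

End model.

Arguments standard_wiener {d T R} P W.
Arguments process_sigma {d T R P} W.
Arguments real_cdf {d T R} P X r.

(* Main.v *)
(* Conditioning on (mu, sigma, tau) and using the Gaussian moment generating
   function gives phi_nu(q) = E phi_tau(<u(q), Theta>).  As z_2 >= 0, the ratio
   <u(q), z> / q is nondecreasing in q.  For q < q_+ this keeps <u(q), Theta>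
   uniformly below q_tau on the support D, so phi_nu(q) is finite; for q > q_+
   some point of D, hence a set of positive probability, has
   <u(q), Theta> > q_tau, so phi_nu(q) = +oo.  At q = q_+ one has
   <u(q_+), Theta> = q_tau - H with H >= 0 almost surely, and on {H > delta}
   the integrand is at most phi_tau(q_tau - delta) < +oo, so only {H <= delta}
   can make phi_nu(q_+) infinite. *)

Require Import Defs.
From HB Require Import structures.
From mathcomp Require Import all_boot all_order all_algebra.
From mathcomp Require Import all_classical all_reals all_analysis.
From mathcomp Require Import measurable_realfun ring lra.

Import Order.TTheory GRing.Theory Num.Theory.
Import numFieldNormedType.Exports.

Local Open Scope classical_set_scope.
Local Open Scope ring_scope.
Set Implicit Arguments.
Unset Strict Implicit.

(** * Integrals of functions of independent variables *)

Section integral_of_independent_pair.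
Local Open Scope ereal_scope.
Context {d d1 d2} {T : measurableType d} {T1 : measurableType d1}
  {T2 : measurableType d2} {R : realType}.
Variables (P : probability T R).

(** The product rule on rectangles makes the joint law the product of the marginal laws, and Tonelli
    does the rest. *)
Lemma ge0_integral_indep_pair (X : {RV P >-> T1}) (Y : {RV P >-> T2})
    (f : T1 * T2 -> \bar R) :
  (forall A B, measurable A -> measurable B ->
    P (X @^-1` A `&` Y @^-1` B) = P (X @^-1` A) * P (Y @^-1` B)) ->
  measurable_fun setT f -> (forall x, 0 <= f x) ->
  \int[P]_w f (X w, Y w) = \int[P]_w \int[P]_v f (X w, Y v).
Proof.
move=> XY mf f0.
have mXY : measurable_fun setT (fun w => (X w, Y w)).
  exact: measurable_fun_pair.
pose Z : {RV P >-> (T1 * T2)%type} := HB.pack (fun w => (X w, Y w))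
  (isMeasurableFun.Build _ _ _ _ _ mXY).
rewrite -[LHS](ge0_integral_distribution Z)//.
rewrite (eq_measure_integral (distribution P X \x distribution P Y));
  last first.
  move=> A mA _; apply/esym.
  by apply: product_measure_unique => // B C mB mC; exact: XY.
rewrite fubini_tonelli1// ge0_integral_distribution//; last 2 first.
- exact: measurable_fun_fubini_tonelli_F.
- by move=> x; exact: integral_ge0.
apply: eq_integral => w _ /=; rewrite /fubini_F ge0_integral_distribution//.
exact: measurable_fun_pair2.
Qed.

End integral_of_independent_pair.

Section integral_of_independent_triple.
Local Open Scope ereal_scope.
Context {d d1 d2 d3} {T : measurableType d} {T1 : measurableType d1}
  {T2 : measurableType d2} {T3 : measurableType d3} {R : realType}.
Variables (P : probability T R).

Lemma ge0_integral_indep_triple (X : {RV P >-> T1}) (Y : {RV P >-> T2})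
    (Z : {RV P >-> T3}) (f : T1 * (T2 * T3) -> \bar R) :
  (forall A B C, measurable A -> measurable B -> measurable C ->
    P (X @^-1` A `&` (Y @^-1` B `&` Z @^-1` C)) =
    P (X @^-1` A) * (P (Y @^-1` B) * P (Z @^-1` C))) ->
  measurable_fun setT f -> (forall x, 0 <= f x) ->
  \int[P]_w f (X w, (Y w, Z w)) =
  \int[P]_u \int[P]_v \int[P]_w f (X u, (Y v, Z w)).
Proof.
move=> XYZ mf f0.
have YZ B C : measurable B -> measurable C ->
    P (Y @^-1` B `&` Z @^-1` C) = P (Y @^-1` B) * P (Z @^-1` C).
  move=> mB mC; have := XYZ setT B C measurableT mB mC.
  by rewrite preimage_setT setTI probability_setT mul1e.
have mYZ : measurable_fun setT (fun w => (Y w, Z w)).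
  exact: measurable_fun_pair.
pose V : {RV P >-> (T2 * T3)%type} := HB.pack (fun w => (Y w, Z w))
  (isMeasurableFun.Build _ _ _ _ _ mYZ).
rewrite (@ge0_integral_indep_pair _ _ _ _ _ _ _ P X V f)//=.
  apply: eq_integral => u _.
  rewrite (ge0_integral_indep_pair (f := fun z => f (X u, z)))//.
  exact: measurable_fun_pair2.
(* Independence is given on boxes only, while here [S] is an arbitrary measurable subset of the
   plane [T2 * T3]. For fixed [A] both sides are measures in [S] that agree on rectangles; absorbing
   the scalar [p] into the first factor lets uniqueness of product measures apply. *)
move=> A S mA mS.
have mXA : measurable (X @^-1` A).
  by rewrite -[_ @^-1` _]setTI; exact: measurable_funPT.
have p0 : (0 <= fine (P (X @^-1` A)))%R by rewrite fine_ge0.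
pose p := NngNum p0.
pose lawYZ := distribution P Y \x distribution P Z.
have -> : P (V @^-1` S) = lawYZ S.
  by apply/esym/(product_measure_unique (m' := distribution P V)).
pose m1 := mscale p (distribution P Y).
have rect B C : measurable B -> measurable C ->
    P (X @^-1` A `&` V @^-1` (B `*` C)) = m1 B * distribution P Z C.
  move=> mB mC; rewrite /m1 /mscale/= fineK ?fin_num_measure// -muleA.
  exact: XYZ.
transitivity ((m1 \x distribution P Z) S).
  rewrite (product_measure_unique (m' := pushforward (mrestr P mXA) V))//.
    by rewrite /= /pushforward /mrestr setIC.
  by move=> B C mB mC; rewrite /= /pushforward /mrestr setIC; exact: rect.
rewrite (product_measure_unique (m' := mscale p lawYZ))//=.
  by rewrite /mscale/= fineK ?fin_num_measure.
move=> B C mB mC.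
by rewrite /mscale/= /lawYZ product_measure1E// muleA.
Qed.
End integral_of_independent_triple.

(** * Gaussian moment generating function *)

(** Completing the square: exponential tilting by c moves the mean from 0 to c s^2. *)
Lemma normal_pdf_expR (R : realType) (c s x : R) : s != 0 ->
  expR (c * x) * normal_pdf 0 s x =
  expR (c ^+ 2 * s ^+ 2 / 2) * normal_pdf (c * s ^+ 2) s x.
Proof.
move=> s0; rewrite !normal_pdfE// /normal_fun mulrCA -expRD [RHS]mulrCA -expRD.
by congr (_ * expR _); field.
Qed.

Lemma integral_normal_probE (R : realType) (m s : R) (f : R -> \bar R) :
  measurable_fun setT f -> (forall x, 0 <= f x)%E ->
  (\int[normal_prob m s]_x f x =
   \int[lebesgue_measure]_x (f x * (normal_pdf m s x)%:E))%E.
Proof.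
move=> mf f0.
rewrite -(Radon_Nikodym_SigmaFinite.change_of_variables
  (normal_prob_dominates m s))//.
apply: ae_eq_integral => //.
- apply: emeasurable_funM => //.
  apply: (measurable_int lebesgue_measure).
  exact/Radon_Nikodym_SigmaFinite.f_integrable/normal_prob_dominates.
- apply: emeasurable_funM => //; apply/measurable_EFinP.
  exact: measurable_normal_pdf.
(* The abstract Radon-Nikodym derivative and the explicit density have the same integral over every
   measurable set, hence agree almost everywhere. *)
- suff : ae_eq lebesgue_measure setT (Radon_Nikodym_SigmaFinite.f
      (normal_prob m s) lebesgue_measure) (EFin \o normal_pdf m s).
    by apply: filterS => x /= /[apply] ->.
  apply: integral_ae_eq => //.
  + exact/Radon_Nikodym_SigmaFinite.f_integrable/normal_prob_dominates.
  + by apply/measurable_EFinP; exact: measurable_normal_pdf.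
  + move=> A _ mA; rewrite -Radon_Nikodym_SigmaFinite.f_integral//.
    exact: normal_prob_dominates.
Qed.

Lemma integral_expR_normal_prob (R : realType) (c s : R) : s != 0 ->
  (\int[normal_prob 0 s]_x (expR (c * x))%:E = (expR (c ^+ 2 * s ^+ 2 / 2))%:E)%E.
Proof.
move=> s0; rewrite integral_normal_probE//; last first.
  by apply/measurable_EFinP/measurableT_comp => //; exact: mulrl_measurable.
under eq_integral do rewrite -EFinM normal_pdf_expR// EFinM.
rewrite ge0_integralZl//; last 2 first.
- by apply/measurable_EFinP; exact: measurable_normal_pdf.
- by move=> x _; rewrite lee_fin normal_pdf_ge0.
by rewrite integral_normal_pdf mule1.
Qed.

(** * The moment generating function of the log-loss *)

Section nonmeasurable_integral.
Local Open Scope ereal_scope.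
Context {d} {T : measurableType d} {R : realType}.
Variable m : {measure set T -> \bar R}.

(** The integral of a nonnegative function is a supremum over the simple functions below it, so
    monotonicity needs no measurability. *)
Lemma ge0_le_integral_nonmeasurable (f g : T -> \bar R) : (forall x, 0 <= f x) ->
  (forall x, f x <= g x) -> \int[m]_x f x <= \int[m]_x g x.
Proof.
move=> f0 fg.
have g0 x : 0 <= g x by exact: le_trans (fg x).
rewrite !ge0_integralTE//.
apply: ge_ereal_sup => _ [h hf <-]; apply: ereal_sup_ubound.
by exists h => // x; exact: le_trans (fg x).
Qed.

(* Meant for f = exp (q nu), which involves W sampled at tau and is only almost
   everywhere equal to a measurable function. *)
Lemma ge0_ae_eq_integral_nonmeasurable (f g : T -> \bar R) :
  (forall x, 0 <= f x) -> (forall x, 0 <= g x) -> measurable_fun setT g ->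
  {ae m, forall x, f x = g x} -> \int[m]_x f x = \int[m]_x g x.
Proof.
move=> f0 g0 mg [N [mN N0 fgN]].
have fgE x : ~ N x -> f x = g x by move=> Nx; apply: contrapT => /fgN.
have mNC : measurable (~` N) by exact: measurableC.
(* Off the null set [N], f equals g. Setting g to 0 or to +oo on [N] gives measurable functions
   below and above f, both with the integral of g. *)
have mlo : measurable_fun setT (g \_ (~` N)).
  apply/(measurable_restrictT g mNC); exact: measurable_funTS.
pose hi := (fun x => if x \in N then +oo else g x).
have mhi : measurable_fun setT hi.
  apply: measurable_fun_ifT => //; apply: (measurable_fun_bool true).
  rewrite setTI (_ : _ @^-1` _ = N)//.
  by apply/seteqP; split => x /=; [exact: set_mem|exact: mem_set].
have ae_out (h : T -> \bar R) : (forall x, ~ N x -> h x = g x) ->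
    ae_eq m setT h g.
  move=> hg; exists N; split => // x /= /not_implyP[_ hx].
  by apply: contrapT => /hg.
apply/eqP; rewrite eq_le; apply/andP; split.
- rewrite -(ge0_ae_eq_integral (f := hi) (g := g))//.
  + apply: ge0_le_integral_nonmeasurable => // x; rewrite /hi.
    case: ifPn; first by rewrite leey.
    by rewrite notin_setE => /fgE ->.
  + by move=> x _; rewrite /hi; case: ifP.
  + by apply: ae_out => x Nx; rewrite /hi ifF//; apply/negbTE; rewrite notin_setE.
- rewrite -(ge0_ae_eq_integral (f := g \_ (~` N)) (g := g))//.
  + apply: ge0_le_integral_nonmeasurable => x; rewrite patchE; case: ifPn => //.
    by rewrite in_setC notin_setE => /fgE ->.
  + by move=> x _; exact: erestrict_ge0.
  + by apply: ae_out => x Nx; rewrite patchE ifT// in_setC notin_setE.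
Qed.

End nonmeasurable_integral.

(** * Approximating a time from above by grid points *)

Section next_grid.
Context {R : realType}.

(** For t >= 0, the least multiple of 1/(n+1) strictly above t. The value is positive for every t,
    so a process is only ever sampled at nonnegative times. *)
Definition next_grid (n : nat) (t : R) : R :=
  (Num.truncn (t * n.+1%:R)).+1%:R / n.+1%:R.

Lemma cvg_next_grid t : 0 <= t -> next_grid ^~ t @ \oo --> t.
Proof.
move=> t0; apply: (@squeeze_cvgr _ _ _ _ (cst t) (fun n => t + harmonic n)).
- near=> n; have n0 : (0 : R) < n.+1%:R by [].
  have /andP[le_t lt_t] := @truncn_itv _ (t * n.+1%:R) (mulr_ge0 t0 (ltW n0)).
  rewrite /next_grid /cst /= ler_pdivlMr// ltW//=.
  by rewrite ler_pdivrMr// mulrDl mulVf ?gt_eqF// -natr1 lerD2r.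
- exact: cvg_cst.
- rewrite -[X in _ --> X]addr0; apply: cvgD; first exact: cvg_cst.
  exact: cvg_harmonic.
Unshelve. all: by end_near. Qed.

Lemma measurable_grid_cell n k :
  measurable [set t : R | Num.truncn (t * n.+1%:R) = k].
Proof.
have mle j : measurable [set t : R | (Num.truncn (t * n.+1%:R) <= j)%N].
  rewrite (_ : [set _ | _] = `]-oo, j.+1%:R / n.+1%:R[%classic)//.
  by apply/seteqP; split => t /=; rewrite in_itv/= truncn_le_nat ltr_pdivlMr.
case: k => [|k].
  rewrite (_ : [set _ | _] = [set t : R | (Num.truncn (t * n.+1%:R) <= 0)%N])//.
  by apply/seteqP; split => t /=; rewrite leqn0 => /eqP.
rewrite (_ : [set _ | _] = [set t : R | (Num.truncn (t * n.+1%:R) <= k.+1)%N] `\`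
  [set t : R | (Num.truncn (t * n.+1%:R) <= k)%N]); first exact: measurableD.
apply/seteqP; split => t /=; first by move=> ->; rewrite ltnn.
by move=> [le_k /negP]; rewrite -ltnNge => lt_k; apply/eqP; rewrite eqn_leq le_k.
Qed.

(** On each of the countably many cells [E k] the grid time is constant, so only measurability of
    [V] at a fixed time is used. *)
Lemma measurable_grid_sample {d} {T' : measurableType d} {d'}
    {S : measurableType d'} (V : R -> T' -> S) n :
  (forall t, 0 <= t -> measurable_fun setT (V t)) ->
  measurable_fun setT (fun z : R * T' => V (next_grid n z.1) z.2).
Proof.
move=> mV.
pose E k : set (R * T') := fst @^-1` [set t : R | Num.truncn (t * n.+1%:R) = k].
have mE k : measurable (E k).
  rewrite -[E k]setTI; apply: measurable_fst => //.
  exact: measurable_grid_cell.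
have -> : [set: R * T'] = \bigcup_k E k.
  by apply/seteqP; split => // -[t w] _; exists (Num.truncn (t * n.+1%:R)).
apply/measurable_fun_bigcup => // k.
apply: (eq_measurable_fun (fun z : R * T' => V (k.+1%:R / n.+1%:R) z.2)).
  by move=> z /[!inE] /= zk; rewrite /next_grid zk.
apply: measurable_funTS; apply: measurableT_comp => //; apply: mV.
by rewrite divr_ge0.
Qed.

End next_grid.

(** * Sampling the Wiener process at an independent time *)

Section wiener_sampling.
Context {d} {T : measurableType d} {R : realType}.
Variables (P : probability T R) (W : R -> {RV P >-> R}).
Hypothesis W_wiener : standard_wiener P W.

Local Notation path_events :=
  (\bigcup_(t in [set t : R | 0 <= t]) g_sigma_algebra_preimage (W t)).
Local Notation pathType := (g_sigma_algebraType path_events).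

Lemma measurable_wiener_path t : 0 <= t ->
  measurable_fun setT (W t : pathType -> R).
Proof.
move=> t0 _ A mA; rewrite setTI; apply: sub_sigma_algebra.
by exists t => //; exists A => //; rewrite setTI.
Qed.

(** The identity into the sample space with only the path events stands for the whole path of [W] as
    one random element, to which the independence hypothesis applies. *)
Lemma measurable_to_path : measurable_fun setT (id : T -> pathType).
Proof.
move=> _ A mA; rewrite setTI; apply: smallest_sub mA.
  exact: sigma_algebra_measurable.
by move=> _ [t _ [B mB <-]]; exact: measurable_funPT.
Qed.

(** Only increments have a prescribed law; since [W 0] vanishes almost surely, [W t] may be replaced
    by the increment over [0, t]. *)
Lemma wiener_mgf (c t : R) : 0 < t ->
  (\int[P]_w (expR (c * W t w))%:E = (expR (c ^+ 2 * t / 2))%:E)%E.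
Proof.
move=> t0; have st0 : Num.sqrt t != 0 by rewrite gt_eqF// sqrtr_gt0.
have mexp : measurable_fun setT (fun x : R => (expR (c * x))%:E).
  by apply/measurable_EFinP/measurableT_comp => //; exact: mulrl_measurable.
have mexpV (V : {RV P >-> R}) :
    measurable_fun setT (fun w => (expR (c * V w))%:E).
  exact: (measurableT_comp mexp).
transitivity (\int[P]_w (expR (c * (W t \- W 0) w))%:E)%E.
  apply: ge0_ae_eq_integral => //.
    exact: mexpV.
  by apply: filterS (wiener0 W_wiener) => w W0 _ /=; rewrite W0 subr0.
rewrite -[LHS](ge0_integral_distribution (W t \- W 0)%R
  (f := fun x => (expR (c * x))%:E))//.
pose N := normal_prob 0 (Num.sqrt t).
(* R and measurableTypeR R carry the same sigma-algebra under different
   displays, so integrals have to be transported along the identity. *)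
have mid : measurable_fun setT (id : measurableTypeR R -> R).
  by move=> _ A mA; rewrite setTI.
rewrite (eq_measure_integral (pushforward N (id : measurableTypeR R -> R)));
  last first.
  move=> A mA _; rewrite /pushforward/= /N -[in RHS](subr0 t).
  exact: (wiener_normal_increments W_wiener).
rewrite ge0_integral_pushforward//=.
by rewrite integral_expR_normal_prob// sqr_sqrtr// ltW.
Qed.

Let loss (x : (R * R) * R) (y : R) : R :=
  - (x.1.1 - x.1.2 ^+ 2 / 2) * x.2 - x.1.2 * y.

(* W is not assumed jointly measurable in (t, w), but its samples at the grid
   points decreasing to t are, and their limit is W t along continuous paths. *)
Definition sampled_exp_loss (q : R) (x : (R * R) * (R * pathType)) : \bar R :=
  limn_esup (fun n =>
    (expR (loss (x.1, x.2.1) (W (next_grid n x.2.1) x.2.2) * q))%:E).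

Lemma sampled_exp_loss_ge0 q x : (0 <= sampled_exp_loss q x)%E.
Proof. by apply: limf_esup_ge0 => //; apply: filter_not_empty. Qed.

Lemma measurable_sampled_exp_loss q : measurable_fun setT (sampled_exp_loss q).
Proof.
pose S := ((R * R) * (R * pathType))%type.
have m11 : measurable_fun setT (fun x : S => x.1.1).
  exact: (measurableT_comp measurable_fst measurable_fst).
have m12 : measurable_fun setT (fun x : S => x.1.2).
  exact: (measurableT_comp measurable_snd measurable_fst).
have m21 : measurable_fun setT (fun x : S => x.2.1).
  exact: (measurableT_comp measurable_fst measurable_snd).
apply: measurable_fun_limn_esup => n.
apply/measurable_EFinP/measurableT_comp => //.
apply: measurable_funM => //; apply: measurable_funB.
  apply: measurable_funM => //; apply: measurableT_comp => //.
  apply: measurable_funB => //; apply: measurable_funM => //.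
  exact: measurable_funX.
apply: measurable_funM => //.
apply: (measurableT_comp (f := fun z : R * pathType => W (next_grid n z.1) z.2)).
  apply: (@measurable_grid_sample R _ pathType _ R (fun t w => W t w)) => t t0.
  exact: measurable_wiener_path.
exact: measurable_snd.
Qed.

Lemma sampled_exp_lossE q m s t w : 0 < t ->
  {within `[0, +oo[, continuous (fun t => W t w)} ->
  sampled_exp_loss q ((m, s), (t, w)) = (expR (loss ((m, s), t) (W t w) * q))%:E.
Proof.
move=> t0 /continuous_within_itvcyP[Wc _].
have Wt : W (next_grid n t) w @[n --> \oo] --> W t w.
  apply: (@cvg_comp _ _ _ (next_grid ^~ t) (fun t => W t w) _ (nbhs t)).
    exact/cvg_next_grid/ltW.
  by apply: Wc; rewrite in_itv/= t0.
suff cv : (expR (loss (m, s, t) (W (next_grid n t) w) * q))%:E @[n --> \oo] -->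
    (expR (loss (m, s, t) (W t w) * q))%:E.
  rewrite /sampled_exp_loss is_cvg_limn_esupE; first exact/cvg_lim.
  by apply/cvg_ex; eexists; exact: cv.
apply: cvg_EFin; first by near=> n.
apply: (cvg_comp (fun n => loss (m, s, t) (W (next_grid n t) w) * q) expR);
  last exact: continuous_expR.
apply: cvgMl; apply: cvgB; first exact: cvg_cst.
by apply: cvgMr.
Unshelve. all: by end_near. Qed.

(** This is where u(q) comes from: the Gaussian factor with c = - s q adds q^2 s^2 t / 2 to the
    exponent - q (m - s^2 / 2) t, and the sum is t times the inner product of u(q) with (m, s^2 /
    2). *)
Lemma integral_sampled_exp_loss q m s t : 0 < t ->
  (\int[P]_w sampled_exp_loss q ((m, s), (t, w)) =
   (expR (t * dot2 (uvec q) (m, s ^+ 2 / 2)))%:E)%E.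
Proof.
move=> t0; set a := expR (- (m - s ^+ 2 / 2) * t * q).
transitivity (\int[P]_w (a%:E * (expR (- (s * q) * W t w))%:E))%E.
  apply: ge0_ae_eq_integral => //.
  - apply: (measurableT_comp (measurable_sampled_exp_loss q)).
    do 2 apply: measurable_fun_pair => //.
    exact: measurable_to_path.
  - apply: emeasurable_funM => //.
    apply/measurable_EFinP/measurableT_comp => //.
    exact: measurable_funM.
  - by move=> w _; exact: sampled_exp_loss_ge0.
  - by move=> w _; rewrite -EFinM lee_fin mulr_ge0 ?expR_ge0.
  - apply: filterS (wiener_continuous_paths W_wiener) => w Wc _.
    rewrite sampled_exp_lossE// -EFinM -expRD /loss/=; congr (expR _)%:E; ring.
rewrite ge0_integralZl//; last 2 first.
- by apply/measurable_EFinP/measurableT_comp => //; exact: measurable_funM.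
- by rewrite lee_fin expR_ge0.
by rewrite wiener_mgf// -EFinM -expRD /dot2/=; congr (expR _)%:E; field.
Qed.

End wiener_sampling.

(** * Reduction to the moment generating function of the duration *)

Section mgf.
Context {d} {T : measurableType d} {R : realType}.
Variables (P : probability T R) (mu sigma tau : {RV P >-> R}).
Variable W : R -> {RV P >-> R}.
Hypothesis W_wiener : standard_wiener P W.
Hypothesis indep : independent_sigma P (fun i : 'I_3 =>
     tnth [tuple g_sigma_algebra_preimage (fun w => (mu w, sigma w));
                 g_sigma_algebra_preimage tau;
                 process_sigma W] i).
Hypothesis tau_gt0 : {ae P, forall w, 0 < tau w}.

Lemma mgf_log_loss q : 'M_P (log_loss mu sigma tau W) q =
  (\int[P]_w 'M_P tau (dot2 (uvec q) (Theta mu sigma w)))%E.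
Proof.
pose S := g_sigma_algebraType
  (\bigcup_(t in [set t : R | 0 <= t]) g_sigma_algebra_preimage (W t)).
have mms : measurable_fun setT (fun w => (mu w, sigma w)).
  exact: measurable_fun_pair.
pose MS : {RV P >-> (R * R)%type} := HB.pack (fun w => (mu w, sigma w))
  (isMeasurableFun.Build _ _ _ _ _ mms).
have mid : measurable_fun setT (id : T -> S) by exact: measurable_to_path.
pose Id : {RV P >-> S} := HB.pack (id : T -> S)
  (isMeasurableFun.Build _ _ _ _ _ mid).
(* Almost surely tau is positive and the path continuous, and then exp(q nu) equals this jointly
   measurable function of three independent random elements. *)
transitivity (\int[P]_w sampled_exp_loss (W := W) q (MS w, (tau w, Id w)))%E.
  rewrite /mmt_gen_fun unlock /=.
  apply: ge0_ae_eq_integral_nonmeasurable => //.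
  - by move=> w; exact: sampled_exp_loss_ge0.
  - apply: (measurableT_comp (measurable_sampled_exp_loss (W := W) q)).
    by do 2 apply: measurable_fun_pair => //.
  - have := wiener_continuous_paths W_wiener.
    apply: filterS2 tau_gt0 => w tw Wc.
    by rewrite sampled_exp_lossE.
rewrite ge0_integral_indep_triple; last 3 first.
- move=> A B C mA mB mC.
  pose F (i : 'I_3) := tnth [tuple MS @^-1` A; tau @^-1` B; Id @^-1` C] i.
  have := @indep F; rewrite !big_ord_recl big_ord0 mule1 => <-.
  + congr (P _); apply/seteqP; split => w.
      by move=> [Aw [Bw Cw]] [[|[|[|//]]] i3] _ /=.
    move=> FI; split; last split.
    * exact: (FI ord0).
    * exact: (FI (lift ord0 ord0)).
    * exact: (FI (lift ord0 (lift ord0 ord0))).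
  + case=> [[|[|[|//]]] i3]; rewrite /F /tnth/=.
    * by exists A => //; rewrite setTI.
    * by exists B => //; rewrite setTI.
    * exact: mC.
- exact: measurable_sampled_exp_loss.
- exact: sampled_exp_loss_ge0.
(* The path is integrated out first, with the other variables frozen; what remains is the integral
   of exp(tau x) with x the inner product of u(q) and Theta. *)
apply: eq_integral => u _; rewrite /mmt_gen_fun unlock /=.
apply: ge0_ae_eq_integral_nonmeasurable => //.
- by move=> v; apply: integral_ge0 => w _; exact: sampled_exp_loss_ge0.
- apply/measurable_EFinP/measurableT_comp => //.
  exact: measurable_funM.
- by apply: filterS tau_gt0 => v tv; rewrite integral_sampled_exp_loss.
Qed.

Lemma measurable_mgf : measurable_fun setT ('M_P tau).
Proof.
pose f (z : R * T) := (expR (tau z.2 * z.1))%:E.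
have mf : measurable_fun setT f.
  apply/measurable_EFinP/measurableT_comp => //; apply: measurable_funM => //.
  exact: (measurableT_comp (measurable_funPT tau) measurable_snd).
have := @measurable_fun_fubini_tonelli_F _ _ R T R P f mf.
rewrite /fubini_F /mmt_gen_fun unlock; apply.
by move=> z; rewrite lee_fin expR_ge0.
Qed.

Lemma mgf_ge0 (X : T -> R) q : (0 <= 'M_P X q)%E.
Proof. by rewrite /mmt_gen_fun; apply: expectation_ge0 => w; exact: expR_ge0. Qed.

Lemma mgf_nondecreasing : {homo 'M_P tau : p q / p <= q >-> (p <= q)%E}.
Proof.
move=> p q pq; rewrite /mmt_gen_fun unlock.
have mexp r : measurable_fun setT (fun w => (expR (tau w * r))%:E).
  by apply/measurable_EFinP/measurableT_comp => //; exact: measurable_funM.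
apply: ae_ge0_le_integral => //.
- by move=> w _; rewrite lee_fin expR_ge0.
- exact: mexp.
- by move=> w _; rewrite lee_fin expR_ge0.
- exact: mexp.
apply: filterS tau_gt0 => w tw _.
by rewrite lee_fin ler_expR /= ler_wpM2l// ltW.
Qed.

Lemma mgf0 (X : T -> R) : 'M_P X 0 = 1%E.
Proof.
rewrite /mmt_gen_fun -(expectation_cst P 1); congr expectation.
by apply/funext => w /=; rewrite mulr0 expR0.
Qed.

End mgf.

(** * Distribution functions, supports and rays *)

Section real_cdf_integral.
Local Open Scope ereal_scope.
Context {d} {T : measurableType d} {R : realType}.
Variables (P : probability T R) (X : {RV P >-> R}).

(** The Stieltjes measure of the distribution function is the law of [X], so this is a change of
    variables. [X'] is [X] with its codomain under the other display. *)
Lemma ge0_integral_real_cdf (A : set R) (f : R -> \bar R) :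
  measurable A -> measurable_fun setT f -> (forall x, 0 <= f x) ->
  \int[lebesgue_stieltjes_measure (real_cdf P X)]_(x in A) f x =
  \int[P]_(w in X @^-1` A) f (X w).
Proof.
move=> mA mf f0.
have mX : measurable_fun setT (X : T -> measurableTypeR R).
  by move=> _ B mB; exact: measurable_funPT.
pose X' : {RV P >-> measurableTypeR R} := HB.pack (X : T -> measurableTypeR R)
  (isMeasurableFun.Build _ _ _ _ _ mX).
transitivity (\int[distribution P X']_(x in A) f x).
  apply: eq_measure_integral => B mB _.
  exact: (lebesgue_stieltjes_cdf_id (distribution P X')).
rewrite ge0_integral_pushforward//.
by move=> _ B mB; exact: (measurable_funTS mf mA).
Qed.

End real_cdf_integral.

(** * The support of a law in the plane *)

Section support.
Context {R : realType}.

(** A countable base of the plane: open rectangles with rational corners, indexed by their codes; an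
    index that codes nothing gives the empty set. *)
Definition rat_box (k : nat) : set (R * R) :=
  if unpickle k is Some (a, b, c, e) then
    `]ratr a, ratr b[%classic `*` `]ratr c, ratr e[%classic
  else set0.

Lemma measurable_rat_box k : measurable (rat_box k).
Proof.
rewrite /rat_box; case: (unpickle k) => // -[[[a b] c] e].
by apply: measurableX; exact: measurable_itv.
Qed.

Lemma open_rat_box (U : set (R * R)) z : open U -> U z ->
  exists2 k, rat_box k z & rat_box k `<=` U.
Proof.
move=> oU Uz; have /nbhs_ballP[e /= e0 zU] : nbhs z U by exact: open_nbhs_nbhs.
have [a] := @rat_in_itvoo R (z.1 - e) z.1 ltac:(by rewrite ltrBlDr ltrDl).
have [b] := @rat_in_itvoo R z.1 (z.1 + e) ltac:(by rewrite ltrDl).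
have [c] := @rat_in_itvoo R (z.2 - e) z.2 ltac:(by rewrite ltrBlDr ltrDl).
have [f] := @rat_in_itvoo R z.2 (z.2 + e) ltac:(by rewrite ltrDl).
rewrite !in_itv/= => /andP[? ?] /andP[? ?] /andP[? ?] /andP[? ?].
exists (pickle (a, b, c, f)); rewrite /rat_box pickleK.
  by split; rewrite /= in_itv/=; apply/andP.
move=> y [/=]; rewrite !in_itv/= => /andP[? ?] /andP[? ?]; apply: zU.
by split; rewrite -ball_normE/= ltr_norml; apply/andP; split; lra.
Qed.

Lemma open_measurable_pair (U : set (R * R)) : open U -> measurable U.
Proof.
move=> oU; rewrite (_ : U = \bigcup_(k in [set k | rat_box k `<=` U]) rat_box k).
  by apply: bigcup_measurable => k _; exact: measurable_rat_box.
apply/seteqP; split => [z Uz|z [k /= kU]]; last exact: kU.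
by have [k kz kU] := open_rat_box oU Uz; exists k.
Qed.

(** A point outside the support has an open null neighbourhood, hence lies in a null rational box;
    the countable union of all null boxes is negligible. *)
Lemma ae_dist_support {d} {T : measurableType d} (m : {measure set T -> \bar R})
    (X : T -> R * R) : measurable_fun setT X ->
  {ae m, forall w, dist_support (pushforward m X) (X w)}.
Proof.
move=> mX.
have mbox k : measurable (X @^-1` rat_box k).
  by rewrite -[_ @^-1` _]setTI; apply: mX => //; exact: measurable_rat_box.
pose F k := if m (X @^-1` rat_box k) == 0%E then X @^-1` rat_box k else set0.
have : m.-negligible (\bigcup_k F k).
  apply: negligible_bigcup => k; rewrite /F.
  case: eqP => m0; last exact: negligible_set0.
  by exists (X @^-1` rat_box k); split.
apply: negligibleS => w /= /existsNP[U /not_implyP[oU /not_implyP[Uw mU]]].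
have [k kw kU] := open_rat_box oU Uw; exists k => //; rewrite /F.
suff -> : m (X @^-1` rat_box k) = 0%E by rewrite eqxx.
apply/eqP; rewrite -measure_le0; apply: (@le_trans _ _ (m (X @^-1` U))).
  apply: le_measure; rewrite ?inE//; last exact: preimage_subset.
  by rewrite -[_ @^-1` _]setTI; apply: mX => //; exact: open_measurable_pair.
by rewrite leNgt; apply/negP.
Qed.

End support.

(** * Rays and their first contact with a set *)

Section rays.
Context {R : realType}.
Implicit Types (q p q_tau : R) (z : R * R) (D : set (R * R)).

Lemma dot2_uvecE q z : dot2 (uvec q) z = q * ((q + 1) * z.2 - z.1).
Proof. by rewrite /dot2 /=; ring. Qed.

(* Monotonicity of q |-> <u(q), z> / q. *)
Lemma dot2_uvec_star p q z : 0 <= p <= q -> 0 <= z.2 ->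
  q * dot2 (uvec p) z <= p * dot2 (uvec q) z.
Proof.
move=> /andP[p0 pq] z0; rewrite !dot2_uvecE mulrCA.
by rewrite !ler_wpM2l ?(le_trans p0)// lerD2r ler_wpM2r// lerD2r.
Qed.

Lemma continuous_dot2_uvec z : continuous (fun q => dot2 (uvec q) z).
Proof.
move=> q; rewrite (_ : (fun q => _) = (fun q => q * ((q + 1) * z.2 - z.1))).
  apply: cvgM; first exact: cvg_id.
  apply: cvgB; last exact: cvg_cst.
  by apply: cvgMl; apply: cvgD; [exact: cvg_id|exact: cvg_cst].
by apply/funext => p; exact: dot2_uvecE.
Qed.

(** Intermediate value theorem on [0, q], starting from the value 0 at q = 0. *)
Lemma Lray_hit q_tau q z : 0 < q_tau -> 0 < q -> 0 <= z.2 ->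
  q_tau <= dot2 (uvec q) z -> exists2 p, 0 < p <= q & Lray q_tau p z.
Proof.
move=> t0 q0 z0 tq.
have u0 : dot2 (uvec 0) z = 0 by rewrite dot2_uvecE mul0r.
have [||p] := @IVT R (fun q => dot2 (uvec q) z) 0 q q_tau (ltW q0).
- by apply: continuous_subspaceT => p; exact: continuous_dot2_uvec.
- by rewrite u0 ge_min le_max tq (ltW t0) orbT.
rewrite in_itv/= => /andP[p0 pq] pt; exists p => //.
rewrite pq andbT lt_neqAle p0 andbT; apply/eqP => p0'.
by move: t0; rewrite -pt -p0' u0 ltxx.
Qed.

Section first_hit.
Variables (q_tau : R) (D : set (R * R)).
Hypothesis q_tau_gt0 : 0 < q_tau.

Lemma first_hit_le q z : D z -> 0 < q -> Lray q_tau q z -> first_hit q_tau D <= q.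
Proof.
move=> Dz q0 qz; apply: ge_inf; last by split => //; exists z.
by exists 0 => p [/ltW].
Qed.

Lemma dot2_lt_first_hit q z : D z -> 0 <= z.2 -> 0 < q < first_hit q_tau D ->
  dot2 (uvec q) z < q_tau.
Proof.
move=> Dz z0 /andP[q0 qD]; rewrite ltNge; apply/negP => tq.
have [p /andP[p0 pq] pz] := Lray_hit q_tau_gt0 q0 z0 tq.
by have := first_hit_le Dz p0 pz; rewrite leNgt (le_lt_trans pq qD).
Qed.

Lemma first_hit_ge0 : 0 <= first_hit q_tau D.
Proof.
rewrite /first_hit; set E := [set q | _].
(* The real infimum of the empty set is 0 by convention. *)
have [->|/set0P E0] := eqVneq E set0; first by rewrite inf0.
by apply: lb_le_inf => // p [/ltW].
Qed.

(** A value above [q_tau] would put z on a ray with parameter p at most the infimum; then p is the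
    infimum and the value is exactly [q_tau]. *)
Lemma dot2_le_at_first_hit z : D z -> 0 <= z.2 ->
  dot2 (uvec (first_hit q_tau D)) z <= q_tau.
Proof.
move=> Dz z0; have := first_hit_ge0; rewrite le_eqVlt => /predU1P[<-|h0].
  by rewrite dot2_uvecE mul0r ltW.
rewrite leNgt; apply/negP => tq.
have [p /andP[p0 pq] pz] := Lray_hit q_tau_gt0 h0 z0 (ltW tq).
have := first_hit_le Dz p0 pz => qp.
have pE : p = first_hit q_tau D by apply/eqP; rewrite eq_le pq.
by case: pz => _ pz; move: tq; rewrite -pE pz ltxx.
Qed.

(** Some ray with parameter p < q meets D at a point z, and the monotone ratio gives <u(q), z> >= (q
    / p) q_tau > q_tau. The point [z0] serves to show that some ray meets D at all. *)
Lemma dot2_gt_first_hit q z0 : D z0 -> 0 < z0.2 -> first_hit q_tau D < q ->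
  exists2 z, D z & q_tau < dot2 (uvec q) z.
Proof.
move=> Dz0 z00 hq.
have [|p [p0 [z [pz Dz]]] pq] :=
    @inf_lt R [set q | 0 < q /\ Lray q_tau q `&` D !=set0] q _ hq.
  (* Chosen so that r >= 1 and (r + 1) z0.2 - z0.1 >= q_tau, whence <u(r), z0> >= q_tau. *)
  pose r := (`|z0.1| + q_tau) / z0.2 + 1.
  have r1 : 1 <= r by rewrite lerDr divr_ge0 ?addr_ge0// ltW.
  have r0 : 0 < r by exact: lt_le_trans r1.
  have [|p /andP[p0 _] pz] := Lray_hit q_tau_gt0 r0 (ltW z00).
    rewrite dot2_uvecE -[leLHS]mul1r; apply: ler_pM => //; first exact: ltW.
    have -> : (r + 1) * z0.2 = `|z0.1| + q_tau + 2 * z0.2.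
      by rewrite /r; field; rewrite gt_eqF.
    by have := ler_norm z0.1; lra.
  by exists p; split => //; exists z0.
case: pz => z20 pz; exists z => //.
have := @dot2_uvec_star p q z; rewrite (ltW p0) (ltW pq) pz => /(_ isT z20) star.
rewrite -(ltr_pM2l p0); apply: lt_le_trans star.
by rewrite ltr_pM2r.
Qed.

End first_hit.
End rays.

Lemma mgf_lty_lt_abscissa {d} {T : measurableType d} {R : realType}
    (P : probability T R) (X : {RV P >-> R}) (q : R) :
  {ae P, forall w, 0 < X w} -> (q%:E < mgf_abscissa P X)%E ->
  ('M_P X q < +oo)%E.
Proof.
move=> X0 /ereal_sup_gt[_ [p /= pX <-]]; rewrite lte_fin => /ltW qp.
by apply: le_lt_trans pX; exact: mgf_nondecreasing.
Qed.

(** * Finiteness below, at and above the first contact *)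

Section level_sets.
Context {d} {T : measurableType d} {R : realType}.
Variables (P : probability T R) (mu sigma tau : {RV P >-> R}) (q_tau : R).
Hypothesis tau_gt0 : {ae P, forall w, 0 < tau w}.
Hypothesis q_tau_gt0 : 0 < q_tau.
Hypothesis mgf_lty : forall q, q < q_tau -> ('M_P tau q < +oo)%E.
Hypothesis mgf_oo : forall q, q_tau <= q -> 'M_P tau q = +oo%E.

Let D := dist_support (pushforward P (Theta mu sigma)).
Let hit := first_hit q_tau D.
Let u q w := dot2 (uvec q) (Theta mu sigma w).

Lemma measurable_Theta : measurable_fun setT (Theta mu sigma).
Proof.
apply: measurable_fun_pair => //; apply: measurable_funM => //.
exact: measurable_funX.
Qed.

Let mu_q q : measurable_fun [set: T] (fun w => u q w).
Proof.
rewrite (_ : (fun w => u q w) =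
  (fun w => - q * mu w + q * (q + 1) * (sigma w ^+ 2 / 2)))//.
apply: measurable_funD; apply: measurable_funM => //.
by apply: measurable_funM => //; exact: measurable_funX.
Qed.

Let mphi q : measurable_fun setT (fun w => 'M_P tau (u q w)).
Proof. exact: (measurableT_comp (measurable_mgf tau)). Qed.

Let ae_D : {ae P, forall w, D (Theta mu sigma w)}.
Proof. exact/ae_dist_support/measurable_Theta. Qed.

Let Theta2_ge0 w : 0 <= (Theta mu sigma w).2.
Proof. by rewrite divr_ge0// sqr_ge0. Qed.

Lemma integral_mgf_lty q : 0 < q < hit -> (\int[P]_w 'M_P tau (u q w) < +oo)%E.
Proof.
(* An intermediate p gives <u(q), z> <= (q / p) <u(p), z> <= (q / p) q_tau on D, a uniform bound
   strictly below [q_tau]. *)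
move=> /andP[q0 qh]; pose p := (q + hit) / 2.
have [qp ph] : q < p /\ p < hit by rewrite /p; split; lra.
have p0 : 0 < p by exact: lt_trans qp.
pose c := q / p * q_tau.
have cq : c < q_tau by rewrite gtr_pMl// ltr_pdivrMr// mul1r.
apply: (@le_lt_trans _ _ (\int[P]_w cst ('M_P tau c) w)%E); last first.
  rewrite integral_cst// [X in (_ * X)%E](@probability_setT _ _ _ P) mule1.
  exact: mgf_lty.
apply: ae_ge0_le_integral => //.
- by move=> w _; exact: mgf_ge0.
- by move=> w _; exact: mgf_ge0.
apply: filterS ae_D => w Dw _; apply: mgf_nondecreasing => //.
have := @dot2_uvec_star _ q p _ _ (Theta2_ge0 w).
rewrite (ltW q0) (ltW qp) => /(_ isT) star.
rewrite /c mulrAC ler_pdivlMr// mulrC; apply: le_trans star _.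
rewrite ler_wpM2l ?(ltW q0)//; apply/ltW.
by apply: (dot2_lt_first_hit q_tau_gt0 Dw) => //; rewrite p0.
Qed.

Lemma integral_mgf_oo q : {ae P, forall w, 0 < sigma w} -> hit < q ->
  (\int[P]_w 'M_P tau (u q w) = +oo)%E.
Proof.
move=> sigma0 hq.
(* Two almost sure events have a common outcome; it yields a point of D with positive second
   coordinate. *)
have [w0 [Dw0 s0]] : exists w, D (Theta mu sigma w) /\ 0 < sigma w.
  have PT : (0 < P setT)%E by rewrite [ltRHS](@probability_setT _ _ _ P).
  have Fae := ae_properfilter_algebraOfSetsType PT.
  by apply: (@filter_ex _ _ Fae); apply: filterS2 ae_D sigma0 => w; split.
have [|z Dz uz] := dot2_gt_first_hit q_tau_gt0 Dw0 _ hq.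
  by rewrite divr_gt0// exprn_gt0.
pose U := [set z : R * R | q_tau < dot2 (uvec q) z].
have oU : open U.
  apply: (@open_comp _ _ (fun z : R * R => dot2 (uvec q) z) [set x | q_tau < x]).
    move=> y _; apply: cvgD; apply: cvgMr; [exact: cvg_fst|exact: cvg_snd].
  exact: open_gt.
(* [U] is an open neighbourhood of the support point z. *)
have PU : (0 < P (Theta mu sigma @^-1` U))%E by exact: Dz.
have mU : measurable (Theta mu sigma @^-1` U).
  rewrite -[_ @^-1` _]setTI; apply: measurable_Theta => //.
  exact: open_measurable_pair.
apply/eqP; rewrite -leye_eq.
apply: (@le_trans _ _ (\int[P]_(w in Theta mu sigma @^-1` U) 'M_P tau (u q w))%E).
  rewrite (eq_integral (cst +oo%E)); last first.
    by move=> w /[!inE] /= Uw; rewrite mgf_oo// ltW.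
  by rewrite integral_cst// gt0_mulye.
by apply: ge0_subset_integral => // w _; exact: mgf_ge0.
Qed.

Lemma integral_mgf_first_hit_oo (theta : R * R) (delta : R) :
  Lray q_tau hit theta -> 0 < delta ->
  (\int[P]_w 'M_P tau (u hit w) = +oo)%E <->
  (\int[lebesgue_stieltjes_measure (real_cdf P (gap mu sigma hit theta))]_(h in
     `[0%R, delta]) 'M_P tau (q_tau - h) = +oo)%E.
Proof.
move=> [_ th] d0; pose H := gap mu sigma hit theta.
have HE w : H w = q_tau - u hit w by rewrite /H /gap /u -th /dot2/=; ring.
pose A := H @^-1` `[0, delta]%classic.
have mA : measurable A.
  by rewrite -[A]setTI; apply: measurable_gap => //; exact: measurable_itv.
rewrite ge0_integral_real_cdf//; last 2 first.
- apply: (measurableT_comp (measurable_mgf tau)).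
  exact: measurable_funB.
- by move=> h; exact: mgf_ge0.
pose J := (\int[P]_(w in A) 'M_P tau (u hit w))%E.
have -> : (\int[P]_(w in A) 'M_P tau (q_tau - H w) = J)%E.
  by apply: eq_integral => w _; rewrite HE subKr.
have mTA : measurable_fun setT (fun w => 'M_P tau (u hit w)) by exact: mphi.
have -> : (\int[P]_w 'M_P tau (u hit w) =
    J + \int[P]_(w in ~` A) 'M_P tau (u hit w))%E.
  rewrite -(setUv A) ge0_integral_setU//; last 4 first.
  - exact: measurableC.
  - by rewrite setUv.
  - by move=> w _; exact: mgf_ge0.
  - by apply/disj_setPCl.
(* Almost surely H >= 0, so off [A] one has H > delta, and the integrand is bounded by its finite
   value at q_tau - delta. *)
have rest : (\int[P]_(w in ~` A) 'M_P tau (u hit w) < +oo)%E.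
  apply: (@le_lt_trans _ _
    (\int[P]_(w in ~` A) cst ('M_P tau (q_tau - delta)) w)%E).
    apply: ae_ge0_le_integral => //.
    - exact: measurableC.
    - by move=> w _; exact: mgf_ge0.
    - exact: measurable_funTS.
    - by move=> w _; exact: mgf_ge0.
    apply: filterS ae_D => w Dw Aw; apply: mgf_nondecreasing => //.
    have := dot2_le_at_first_hit q_tau_gt0 Dw (Theta2_ge0 w).
    rewrite -/hit -/(u hit w) => uw; rewrite lerBrDr -lerBrDl -HE leNgt.
    apply/negP => Hd; apply: Aw; rewrite /A /= in_itv/= (ltW Hd) andbT.
    by rewrite HE subr_ge0.
  rewrite integral_cst; last exact: measurableC.
  have K : 'M_P tau (q_tau - delta) \is a fin_num.
    by rewrite ge0_fin_numE ?mgf_ge0// mgf_lty// ltrBlDr ltrDl.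
  apply: lte_mul_pinfty => //; first exact: mgf_ge0.
  by rewrite ltey_eq fin_num_measure//; exact: measurableC.
have J0 : (0 <= J)%E by apply: integral_ge0 => w _; exact: mgf_ge0.
split => [|->]; last first.
  rewrite addye// gt_eqF// (lt_le_trans (ltNyr 0))// integral_ge0// => w _.
  exact: mgf_ge0.
move=> eJ; apply/eqP; rewrite -leye_eq leNgt; apply/negP => Joo.
by have := lte_add_pinfty Joo rest; rewrite eJ ltxx.
Qed.

End level_sets.

(** * The abscissa of the log-loss and the divergence criterion *)

Theorem theorem2 (d : measure_display) (T : measurableType d) (R : realType)
  (P : probability T R) (mu sigma tau : {RV P >-> R}) (W : R -> {RV P >-> R})
  (mu_low sigma_high : R)
  (W_wiener : standard_wiener P W)
  (indep : independent_sigma P (fun i : 'I_3 =>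
     tnth [tuple g_sigma_algebra_preimage (fun w => (mu w, sigma w));
                 g_sigma_algebra_preimage tau;
                 process_sigma W] i))
  (tau_gt0 : {ae P, forall w, 0 < tau w})
  (mu_ge : {ae P, forall w, mu_low <= mu w})
  (sigma_bounds : {ae P, forall w, 0 < sigma w <= sigma_high})
  (drift_gt0 : (0 < 'E_P[fun w => (mu w - sigma w ^+ 2 / 2)%R])%E)
  (q_tau_lty : (mgf_abscissa P tau < +oo)%E)
  (phi_tau_q_tau : 'M_P tau (fine (mgf_abscissa P tau)) = +oo%E) :
  let nu := log_loss mu sigma tau W in
  let q_tau := fine (mgf_abscissa P tau) in
  let D := dist_support (pushforward P (Theta mu sigma)) in
  let q_plus := first_hit q_tau D in
  let q_nu := mgf_abscissa P nu in
  q_nu = q_plus%:E /\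
  (forall theta_plus : R * R, Lray q_tau q_plus theta_plus ->
     let F_H := real_cdf P (gap mu sigma q_plus theta_plus) in
     let J (delta : R) :=
       (\int[lebesgue_stieltjes_measure F_H]_(h in `[0%R, delta])
          'M_P tau (q_tau - h))%E in
     ('M_P nu (fine q_nu) = +oo%E <->
        exists2 delta : R, 0 < delta & J delta = +oo%E) /\
     ('M_P nu (fine q_nu) = +oo%E <->
        forall delta : R, 0 < delta -> J delta = +oo%E)).
Proof.
move=> nu q_tau D q_plus q_nu.
have abscissa_ge0 (X : T -> R) : (0 <= mgf_abscissa P X)%E.
  by apply: ereal_sup_ubound; exists 0 => //=; rewrite mgf0 ltry.
have q_tauE : mgf_abscissa P tau = q_tau%:E.
  by rewrite fineK// ge0_fin_numE.
(* The transform is 1 at 0 but infinite at [q_tau], so the two points differ. *)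
have q_tau_gt0 : 0 < q_tau.
  rewrite lt_neqAle -lee_fin -q_tauE abscissa_ge0 andbT; apply/eqP => q_tau0.
  by move: phi_tau_q_tau; rewrite -/q_tau -q_tau0 mgf0.
have mgf_lty q : q < q_tau -> ('M_P tau q < +oo)%E.
  by move=> qt; apply: mgf_lty_lt_abscissa => //; rewrite q_tauE lte_fin.
have mgf_oo q : q_tau <= q -> 'M_P tau q = +oo%E.
  move=> tq; apply/eqP; rewrite -leye_eq -phi_tau_q_tau.
  exact: mgf_nondecreasing.
have sigma_gt0 : {ae P, forall w, 0 < sigma w}.
  by apply: filterS sigma_bounds => w /andP[].
have nuE q : 'M_P nu q =
    (\int[P]_w 'M_P tau (dot2 (uvec q) (Theta mu sigma w)))%E.
  exact: mgf_log_loss.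
have q_nuE : q_nu = q_plus%:E.
  apply/eqP; rewrite eq_le; apply/andP; split.
    apply: ge_ereal_sup => _ [q /= nu_q <-]; rewrite lee_fin leNgt.
    apply/negP => hq.
    by move: nu_q; rewrite nuE (integral_mgf_oo q_tau_gt0 mgf_oo sigma_gt0 hq).
  rewrite leNgt; apply/negP => lt_hit.
  have q_nu_fin : q_nu \is a fin_num.
    by rewrite ge0_fin_numE ?abscissa_ge0// (lt_trans lt_hit) ?ltry.
  pose s := fine q_nu.
  have sE : q_nu = s%:E by rewrite fineK.
  have s0 : 0 <= s by rewrite -lee_fin -sE abscissa_ge0.
  move: lt_hit; rewrite sE lte_fin => lt_hit.
  (* A point strictly between [q_nu] and [q_plus] has a finite transform, contradicting the
     supremum. *)
  pose q := (s + q_plus) / 2.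
  have qs : s < q by rewrite /q; lra.
  have qh : 0 < q < q_plus by rewrite /q; lra.
  have : (q%:E <= q_nu)%E.
    apply: ereal_sup_ubound; exists q => //=; rewrite nuE.
    exact: (integral_mgf_lty tau_gt0 q_tau_gt0 mgf_lty qh).
  by rewrite sE lee_fin leNgt qs.
split; first exact: q_nuE.
(* The left side of [key] does not involve delta, so divergence for one delta and for all delta
   coincide; delta = 1 serves as witness. *)
move=> theta theta_ray F_H J; rewrite q_nuE [fine _]/= nuE.
have key delta : 0 < delta ->
    (\int[P]_w 'M_P tau (dot2 (uvec q_plus) (Theta mu sigma w)) = +oo)%E <->
    J delta = +oo%E.
  by move=> d0; exact: (integral_mgf_first_hit_oo tau_gt0 q_tau_gt0 mgf_lty).
split; split.
- by move=> oo; exists 1 => //; apply/key.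
- by move=> [delta d0] /(key _ d0).
- by move=> oo delta d0; apply/key.
- by move=> /(_ 1 ltr01) /(key _ ltr01).
Qed.
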